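(* Let $G$ be a finite nilpotent group such that $|\pi(G)|\ge 2$. Then $\Gamma(G)$ is a cograph if and only if $G$ is a cyclic group $C_{p^a q^b}$ with $a,b\ge 1$, where $p,q\in\pi(G)$ are distinct primes.
   Context: For a finite group $G$, the co-maximal subgroup graph $\Gamma(G)$ is the simple undirected graph whose vertices are the non-trivial proper subgroups of $G$, two distinct vertices $H,K$ being adjacent if and only if $HK=G$, where $HK=\{hk: h\in H, k\in K\}$. $\pi(G)$ denotes the set of prime divisors of $|G|$. A graph is a cograph if it has no induced subgraph isomorphic to $P_4$, the path on $4$ vertices. $C_n$ denotes the cyclic group of order $n$. *)

(* Defs.v *)
From HB Require Import structures.
From mathcomp Require Import all_boot all_fingroup all_solvable.

Set Implicit Arguments.
Unset Strict Implicit.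
Unset Printing Implicit Defensive.

Record sgraph : Type := SGraph {
  vertex :> finType;
  adj : rel vertex;
  adj_sym : symmetric adj;
  adj_irr : irreflexive adj
}.

Definition sgraph_iso (X Y : sgraph) : Prop :=
  exists2 f : X -> Y, bijective f & forall x y : X, adj (f x) (f y) = adj x y.

Section Induced.
Variables (X : sgraph) (S : {set X}).

Definition induced_adj : rel {x : X | x \in S} :=
  fun u v => adj (val u) (val v).

Lemma induced_adj_sym : symmetric induced_adj.
Proof. by move=> u v; apply: adj_sym. Qed.

Lemma induced_adj_irr : irreflexive induced_adj.
Proof. by move=> u; apply: adj_irr. Qed.

Definition induced_subgraph : sgraph := SGraph induced_adj_sym induced_adj_irr.
End Induced.

Section Path.
Variable n : nat.

Definition path_adj : rel 'I_n :=
  fun i j => (i.+1 == j :> nat) || (j.+1 == i :> nat).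

Lemma path_adj_sym : symmetric path_adj.
Proof. by move=> i j; rewrite /path_adj orbC. Qed.

Lemma path_adj_irr : irreflexive path_adj.
Proof. by move=> i; rewrite /path_adj orbb gtn_eqF. Qed.

Definition path_graph : sgraph := SGraph path_adj_sym path_adj_irr.
End Path.

Definition cograph (X : sgraph) : Prop :=
  ~ exists S : {set X}, sgraph_iso (induced_subgraph S) (path_graph 4).

Section Comaximal.
Local Open Scope group_scope.
Variables (gT : finGroupType) (G : {group gT}).

Definition comax_vertex : finType :=
  {H : {group gT} | (H \proper G) && (H :!=: 1)}.

(* The product is that of the underlying sets, not the subgroup join. *)
Definition comax_adj : rel comax_vertex :=
  fun H K => (H != K) && (val H * val K == G :> {set gT}).

Lemma comax_adj_sym : symmetric comax_adj.
Proof.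
move=> H K; rewrite /comax_adj eq_sym; congr (_ && _).
by apply/eqP/eqP=> /(congr1 (fun A : {set gT} => A^-1)); rewrite /= invMg !invGid.
Qed.

Lemma comax_adj_irr : irreflexive comax_adj.
Proof. by move=> H; rewrite /comax_adj eqxx. Qed.

Definition comax_graph : sgraph := SGraph comax_adj_sym comax_adj_irr.
End Comaximal.

(* Main.v *)
Require Import Defs.
From mathcomp Require Import all_boot all_fingroup all_solvable.

(** In the forward direction the co-maximal graph contains an induced path as
    soon as the group splits as a direct product [A \x B] with [B] nontrivial
    and [A] a product [M1 * M2] of two proper subgroups: the path is
    [B -- A -- M1 B -- M2] ([dprod_factor_not_cograph]).  Suppose then that
    the graph of a nilpotent group [G] with at least two prime divisors is a
    cograph.  Taking for [A] a Sylow subgroup shows that it is not a product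
    of two proper subgroups, which for a [p]-group means that it is cyclic
    ([pgroup_cyclic_or_mulg]); hence [G] is cyclic.  If three primes divided
    [#|G|], one could take for [A] the Hall subgroup for two of them, which is
    the product of its two Sylow subgroups.

    Conversely, in a cyclic group [H * K = G] holds exactly when the indices
    of [H] and [K] are coprime ([cyclic_mulg_coprime_index]).  On an induced
    path [v0 -- v1 -- v2 -- v3] the indices of [v0] and [v3] share a prime;
    it divides the index neither of [v1] nor of [v2], and these are coprime
    and greater than 1, so that at least three primes divide [#|G|]. *)

Section Cograph.

Set Implicit Arguments.
Unset Strict Implicit.

Variable X : sgraph.

(** The three adjacencies and three non-adjacencies already force the four
    vertices to be distinct. *)
Lemma induced_P4_not_cograph (v0 v1 v2 v3 : X) :
    adj v0 v1 -> adj v1 v2 -> adj v2 v3 ->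
    ~~ adj v0 v2 -> ~~ adj v0 v3 -> ~~ adj v1 v3 ->
  ~ cograph X.
Proof.
move=> a01 a12 a23 /negbTE n02 /negbTE n03 /negbTE n13; apply.
pose v (i : 'I_4) := nth v0 [:: v0; v1; v2; v3] i.
have v_adj i j : adj (v i) (v j) = path_adj i j.
  rewrite /v; case: i j => [[|[|[|[|//]]]] ?] [[|[|[|[|//]]]] ?];
    by rewrite /= ?adj_irr // adj_sym.
(* Distinct vertices of the path on four vertices have distinct
   neighbourhoods. *)
have v_inj : injective v.
  move=> i j eq_v; apply/val_inj/eqP.
  have eq_adj k : path_adj i k = path_adj j k by rewrite -!v_adj eq_v.
  move: (eq_adj ord0) (eq_adj (inord 1)) (eq_adj (inord 2)) (eq_adj ord_max).
  rewrite /path_adj !inordK //.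
  by case: i j {eq_v eq_adj} => [[|[|[|[|//]]]] ?] [[|[|[|[|//]]]] ?].
exists [set v i | i : 'I_4].
have vS i : v i \in [set v i | i : 'I_4] by apply: imset_f.
pose g i : induced_subgraph [set v i | i : 'I_4] := exist _ (v i) (vS i).
have g_inj : injective g by move=> i j /(congr1 val)/v_inj.
have g_bij : bijective g.
  by apply: inj_card_bij => //; rewrite card_sig card_imset.
have [f gK fK] := g_bij; exists f; first by exists g.
by move=> x y; rewrite -{2}(fK x) -{2}(fK y) /= /induced_adj /= v_adj.
Qed.

Lemma induced_P4_vertices :
    (exists S : {set X}, sgraph_iso (induced_subgraph S) (path_graph 4)) ->
  exists v : 'I_4 -> X, forall i j, adj (v i) (v j) = path_adj i j.
Proof.
case=> S [f [g fK gK] f_adj]; exists (fun i => val (g i)) => i j.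
rewrite -[in RHS](gK i) -[in RHS](gK j).
exact: (esym (f_adj (g i) (g j))).
Qed.

End Cograph.

Section Comaximal.

Set Implicit Arguments.
Unset Strict Implicit.

Local Open Scope group_scope.

Variables (gT : finGroupType) (G : {group gT}).

(** Distinctness of the vertices is automatic: [H * H = H] is proper. *)
Lemma comax_adjE (H K : comax_graph G) : adj H K = (val H * val K == G).
Proof.
rewrite /= /comax_adj; case: eqP => // ->.
by rewrite mulGid; have /andP[/proper_neq/negbTE->] := valP K.
Qed.

Lemma dprod_properl (A B : {group gT}) :
  A \x B = G -> B :!=: 1 -> A \proper G.
Proof.
move=> /dprodP[_ defG _ tiAB] ntB.
rewrite properEneq -{2}defG mulG_subl andbT.
apply: contraNneq ntB => AG; rewrite -subG1 -tiAB subsetI subxx andbT.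
by rewrite AG -defG mulG_subr.
Qed.

(** The path is [B -- A -- M1 B -- M2]. *)
Lemma dprod_factor_not_cograph (A B M1 M2 : {group gT}) :
    A \x B = G -> B :!=: 1 -> M1 \proper A -> M2 \proper A ->
    M1 * M2 = A ->
  ~ cograph (comax_graph G).
Proof.
move=> dpG ntB pM1 pM2 defA.
have [_ defG cAB tiAB] := dprodP dpG.
have [sM1 sM2] := (proper_sub pM1, proper_sub pM2).
have ntM1 : M1 :!=: 1.
  by apply: contraTneq pM2 => M1_1; rewrite -defA M1_1 mul1g properxx.
have ntM2 : M2 :!=: 1.
  by apply: contraTneq pM1 => M2_1; rewrite -defA M2_1 mulg1 properxx.
have ntA : A :!=: 1 by apply: contraNneq ntM1 => A1; rewrite -subG1 -A1.
(* As [M :&: B = 1], the product [M * B] has fewer elements than [A * B]. *)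
have mulB_neq (M : {group gT}) : M \proper A -> M * B != G.
  move=> pM; have sM := proper_sub pM; apply: contraTneq (proper_card pM) => MBG.
  have tiMB : M :&: B = 1 by apply/trivgP; rewrite -tiAB setSI.
  rewrite -leqNgt -(leq_pmul2r (cardG_gt0 B)) -(TI_cardMg tiAB).
  by rewrite -(TI_cardMg tiMB) MBG defG.
have sBG : B \subset G by rewrite -defG mulG_subr.
have B_neqG : B :!=: G by rewrite -(mul1g B) mulB_neq // proper1G.
have cB (M : {group gT}) : M \subset A -> M * B = B * M.
  by move=> sM; apply/centC/(subset_trans sM); rewrite centsC.
have M1BE : M1 <*> B = M1 * B by rewrite cent_joinEr // (subset_trans cAB) ?centS.
have pA : (A \proper G) && (A :!=: 1) by rewrite (dprod_properl dpG).
have pB : (B \proper G) && (B :!=: 1) by rewrite properEneq B_neqG sBG.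
have pM1B : (M1 <*> B \proper G) && (M1 <*> B :!=: 1).
  have sM1G : M1 \subset G := subset_trans sM1 (proper_sub (dprod_properl dpG ntB)).
  rewrite properEneq join_subG sM1G sBG !andbT; apply/andP; split.
    by rewrite /= M1BE mulB_neq.
  by apply: contraNneq ntM1 => M1B1; rewrite -subG1 -M1B1 joing_subl.
have pM2G : (M2 \proper G) && (M2 :!=: 1) by rewrite (proper_trans pM2) ?(dprod_properl dpG).
pose vA : comax_graph G := exist _ A pA.
pose vB : comax_graph G := exist _ B pB.
pose vM1B : comax_graph G := exist _ (M1 <*> B)%G pM1B.
pose vM2 : comax_graph G := exist _ M2 pM2G.
apply: (@induced_P4_not_cograph _ vB vA vM1B vM2); rewrite comax_adjE /=.
- by rewrite -cB // defG.
- by rewrite M1BE mulgA mulGSid // defG.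
- by rewrite M1BE -mulgA -cB // mulgA defA defG.
- by rewrite M1BE cB // mulgA mulGid -cB // mulB_neq.
- by rewrite -cB // mulB_neq.
- by rewrite mulGSid // proper_neq // (dprod_properl dpG).
Qed.

End Comaximal.

Section Groups.

Set Implicit Arguments.
Unset Strict Implicit.

Local Open Scope group_scope.

Variables (gT : finGroupType) (G : {group gT}).

(** A maximal subgroup [M] is normal, so [M * <[x]> = G] for any [x] outside
    [M]. *)
Lemma pgroup_cyclic_or_mulg (p : nat) :
    p.-group G ->
  cyclic G \/
    exists M1 M2 : {group gT}, [/\ M1 \proper G, M2 \proper G & M1 * M2 = G].
Proof.
move=> pG; have [-> | ntG] := eqsVneq G 1; first by left; apply: cyclic1.
have [M maxM _] : {M : {group gT} | maximal M G & 1%G \subset M}.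
  by apply: maxgroup_exists; rewrite proper1G.
have pM := maxgroupp maxM; have [sMG [x Gx notMx]] := properP pM.
have sxG : <[x]> \subset G by rewrite cycle_subG.
have [<- | x_neqG] := eqVneq <[x]> (G : {set gT}).
  by left; apply: cycle_cyclic.
right; exists M, <[x]>%G; split=> //; first by rewrite properEneq x_neqG.
apply: mulg_normal_maximal => //; first exact: p_maximal_normal pG maxM.
by rewrite cycle_subG.
Qed.

(** If [d] divides both indices, then [H] and [K] lie in the unique subgroup
    of index [d]. *)
Lemma cyclic_mulg_coprime_index (H K : {group gT}) :
    cyclic G -> H \subset G -> K \subset G ->
  (H * K == G) = coprime #|G : H| #|G : K|.
Proof.
move=> cycG sHG sKG; apply/eqP/idP => [defG | ]; last exact: coprime_index_mulG.
set d := gcdn #|G : H| #|G : K|.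
have [x defx] := cyclicP cycG.
have d_dvdG : d %| #[x].
  by rewrite orderE -defx; apply: dvdn_trans (dvdn_gcdl _ _) (dvdn_indexg _ _).
have d_gt0 : 0 < d by rewrite gcdn_gt0 indexg_gt0.
have sXG : <[x ^+ d]> \subset G by rewrite defx cycleX.
have sX (L : {group gT}) : L \subset G -> d %| #|G : L| -> L \subset <[x ^+ d]>.
  move=> sLG d_dvd; rewrite -(cardSg_cyclic cycG) // -orderE orderXdiv //.
  by rewrite dvdn_divRL // orderE -defx -(Lagrange sLG) dvdn_pmul2l.
suff d_le1 : d <= 1 by rewrite /coprime -/d eqn_leq d_le1.
have: G \subset <[x ^+ d]>.
  by rewrite -defG mulG_subG !sX ?dvdn_gcdl ?dvdn_gcdr.
move/subset_leq_card; rewrite -orderE orderXdiv // defx -orderE.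
by rewrite leq_divRL // -{2}[#[x]]muln1 leq_pmul2l ?order_gt0.
Qed.

Lemma nilpotent_pi_pcore (pi : nat_pred) :
  nilpotent G -> \pi('O_pi(G)) =i [predI \pi(G) & pi].
Proof.
move=> nilG r; rewrite /= (card_Hall (nilpotent_pcore_Hall pi nilG)).
exact: pi_of_part.
Qed.

Lemma pi_mem_neq1 (r : nat) : r \in \pi(G) -> G :!=: 1.
Proof. by apply: contraTneq => G1; rewrite /= G1 cards1. Qed.

End Groups.

Section CographGroups.

Set Implicit Arguments.
Unset Strict Implicit.

Local Open Scope group_scope.

Variables (gT : finGroupType) (G : {group gT}).

(** On an induced path, the indices of the two ends share a prime [r], and
    [r] together with primes [s] and [t] dividing the indices of the two inner
    vertices would be three distinct prime divisors of [#|G|]. *)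
Lemma cyclic_two_primes_cograph :
  cyclic G -> size (primes #|G|) <= 2 -> cograph (comax_graph G).
Proof.
move=> cycG two_primes /induced_P4_vertices[v v_adj].
pose n i := #|G : val (v i)|.
have sVG i : val (v i) \subset G by have /andP[/proper_sub] := valP (v i).
have n_adj i j : coprime (n i) (n j) = path_adj i j.
  by rewrite -cyclic_mulg_coprime_index // -comax_adjE v_adj.
have n_prime i r : prime r -> r %| n i -> r \in primes #|G|.
  move=> r_pr r_dv; rewrite mem_primes r_pr cardG_gt0.
  exact: dvdn_trans r_dv (dvdn_indexg _ _).
have n_neq1 i : n i != 1%N.
  by rewrite indexg_eq1; have /andP[/proper_subn] := valP (v i).
have n01 : coprime (n ord0) (n (inord 1)) by rewrite n_adj /path_adj inordK.
have n12 : coprime (n (inord 1)) (n (inord 2)) by rewrite n_adj /path_adj !inordK.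
have n23 : coprime (n (inord 2)) (n ord_max) by rewrite n_adj /path_adj !inordK.
have n03 : ~~ coprime (n ord0) (n ord_max) by rewrite n_adj.
have pdiv_pr m : m != 1%N -> 0 < m -> prime (pdiv m).
  by move=> m1 m0; rewrite pdiv_prime // ltn_neqAle eq_sym m1.
pose r := pdiv (gcdn (n ord0) (n ord_max)).
pose s := pdiv (n (inord 1)); pose t := pdiv (n (inord 2)).
have r_pr : prime r by rewrite pdiv_pr // gcdn_gt0 indexg_gt0.
have s_pr : prime s by rewrite pdiv_pr ?indexg_gt0.
have t_pr : prime t by rewrite pdiv_pr ?indexg_gt0.
have r_n0 : r %| n ord0 := dvdn_trans (pdiv_dvd _) (dvdn_gcdl _ _).
have r_n3 : r %| n ord_max := dvdn_trans (pdiv_dvd _) (dvdn_gcdr _ _).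
have s_n1 : s %| n (inord 1) := pdiv_dvd _.
have t_n2 : t %| n (inord 2) := pdiv_dvd _.
have neq_pr a b x y : prime x -> coprime a b -> x %| a -> y %| b -> x != y.
  move=> x_pr co_ab xa yb; apply: contraTneq co_ab => xy; rewrite -xy in yb.
  by apply/negP=> /(coprime_dvdl xa)/(coprime_dvdr yb); rewrite prime_coprime ?dvdnn.
have uniq_rst : uniq [:: r; s; t].
  have r_s : r != s := neq_pr _ _ _ _ r_pr n01 r_n0 s_n1.
  have s_t : s != t := neq_pr _ _ _ _ s_pr n12 s_n1 t_n2.
  have t_r : t != r := neq_pr _ _ _ _ t_pr n23 t_n2 r_n3.
  by rewrite /= !inE negb_or r_s s_t eq_sym t_r.
suff /(uniq_leq_size uniq_rst) : {subset [:: r; s; t] <= primes #|G|}.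
  by rewrite leqNgt ltnS two_primes.
move=> x; rewrite !inE => /or3P[]/eqP->.
- exact: n_prime r_n0.
- exact: n_prime s_n1.
- exact: n_prime t_n2.
Qed.

(** The complement ['O_pi^'(G)] of ['O_pi(G)] is nontrivial because of [r]. *)
Lemma cograph_pcore_mulg (pi : nat_pred) (r : nat) (M1 M2 : {group gT}) :
    nilpotent G -> cograph (comax_graph G) -> r \in \pi(G) -> r \notin pi ->
    M1 \proper 'O_pi(G) -> M2 \proper 'O_pi(G) ->
  M1 * M2 != 'O_pi(G).
Proof.
move=> nilG coG rG r_pi pM1 pM2; apply/eqP=> defO.
apply: (dprod_factor_not_cograph (nilpotent_pcoreC pi nilG)) defO coG => //.
by apply: (@pi_mem_neq1 _ _ r); rewrite nilpotent_pi_pcore // inE /= rG.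
Qed.

Lemma cograph_nilpotent_cyclic :
    nilpotent G -> 2 <= size (primes #|G|) -> cograph (comax_graph G) ->
  cyclic G.
Proof.
move=> nilG two_primes coG; apply: nil_Zgroup_cyclic => //.
apply/forall_inP=> P /SylowP[p _ sylP].
have [r rG r_p] : exists2 r, r \in \pi(G) & r \notin (p : nat_pred).
  apply/hasP; apply: contraTT two_primes => /hasPn sub_p; rewrite -ltnNge ltnS.
  apply: (@uniq_leq_size _ _ [:: p]) => [|r /sub_p]; first exact: primes_uniq.
  by rewrite negbK !inE.
have -> : P :=: 'O_p(G) by apply: nilpotent_Hall_pcore.
have [// | [M1 [M2 [pM1 pM2 defO]]]] := pgroup_cyclic_or_mulg (pcore_pgroup p G).
by have /eqP := cograph_pcore_mulg nilG coG rG r_p pM1 pM2.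
Qed.

(** The Hall subgroup for two primes is the product of its Sylow subgroups. *)
Lemma cograph_nilpotent_two_primes :
  nilpotent G -> cograph (comax_graph G) -> size (primes #|G|) <= 2.
Proof.
move=> nilG coG; rewrite leqNgt; apply/negP.
have: {subset primes #|G| <= \pi(G)} by [].
have := primes_uniq #|G|.
case: (primes #|G|) => [|p [|q [|r s]]] //= uniq_pqr sub_pi _.
have [p_q p_r q_r] : [/\ p != q, p != r & q != r].
  by move: uniq_pqr; rewrite !inE !negb_or; case/and3P=> /and3P[? ? _] /andP[? _] _.
have [pG qG rG] : [/\ p \in \pi(G), q \in \pi(G) & r \in \pi(G)].
  by split; apply: sub_pi; rewrite !inE eqxx ?orbT.
pose pi : nat_pred := [pred x | (x == p) || (x == q)].
have nilA : nilpotent 'O_pi(G) by apply: nilpotentS (pcore_sub _ _) nilG.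
have piA := nilpotent_pi_pcore pi nilG.
have dpA := nilpotent_pcoreC p nilA.
have ntM1 : 'O_p('O_pi(G)) != 1.
  apply: (@pi_mem_neq1 _ _ p).
  by rewrite nilpotent_pi_pcore // inE /= piA !inE pG !eqxx.
have ntM2 : 'O_p^'('O_pi(G)) != 1.
  apply: (@pi_mem_neq1 _ _ q).
  by rewrite nilpotent_pi_pcore // inE /= piA !inE qG eqxx orbT eq_sym.
have pM1 := dprod_properl dpA ntM2.
have pM2 : 'O_p^'('O_pi(G)) \proper 'O_pi(G).
  by apply: (@dprod_properl _ _ _ 'O_p('O_pi(G))) => //; rewrite dprodC.
have r_pi : r \notin pi by rewrite !inE negb_or ![r == _]eq_sym p_r.
by have /eqP[] := cograph_pcore_mulg nilG coG rG r_pi pM1 pM2; case/dprodP: dpA.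
Qed.

End CographGroups.

Theorem theorem5p5 (gT : finGroupType) (G : {group gT}) (nilG : nilpotent G)
    (two_primes : 2 <= size (primes #|G|)) :
  cograph (comax_graph G) <->
  cyclic G /\
  exists p q a b : nat,
    [/\ p \in \pi(G) /\ q \in \pi(G), p != q, 1 <= a, 1 <= b
      & #|G| = p ^ a * q ^ b].
Proof.
split=> [coG | [cycG [p [q [a [b [[pG qG] _ a_gt0 b_gt0 oG]]]]]]].
  split; first exact: cograph_nilpotent_cyclic.
  have := cograph_nilpotent_two_primes nilG coG.
  have := prod_prime_decomp (cardG_gt0 G); rewrite prime_decompE.
  have: {subset primes #|G| <= \pi(G)} by [].
  have := primes_uniq #|G|; move: two_primes.
  case: (primes #|G|) => [|p [|q [|r s]]] //= _; rewrite inE andbT => p_q sub_pi.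
  rewrite big_cons big_seq1 /= => oG _.
  have [pG qG] : p \in \pi(G) /\ q \in \pi(G).
    by split; apply: sub_pi; rewrite !inE eqxx ?orbT.
  by exists p, q, (logn p #|G|), (logn q #|G|); split; rewrite ?logn_gt0.
apply: cyclic_two_primes_cograph => //.
have prime_pi r : r \in \pi(G) -> prime r by rewrite mem_primes => /andP[].
have [p_pr q_pr] := (prime_pi p pG, prime_pi q qG).
apply: (@uniq_leq_size _ _ [:: p; q]) => [|r]; first exact: primes_uniq.
rewrite oG primesM ?expn_gt0 ?prime_gt0 // !primesX // !primes_prime //.
by rewrite !inE.
Qed.
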